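(* Let $\mathbb{D}$, $\mathbb{X}=\max(\mathbb{D})$, $\tau_{\mathbb{X}}$ and $C_\Phi$ be as in the context. Then $\max(\mathbb{D})=C_\Phi$. In particular, $\max(\mathbb{D})$ is closed in the Lawson topology of $\mathbb{D}$, and $(\mathbb{X},\tau_{\mathbb{X}})$ is a Stone space (compact, Hausdorff and zero-dimensional) in which the set $\{[L,l] : (L,l)\text{ a pointed image-finite labelled transition system}\}$ is dense.
   Context: Fix a finite set $\mathrm{Act}$ of events. A mixed transition system is $M=(\Sigma,R^a,R^c)$ with $R^a,R^c\subseteq\Sigma\times\mathrm{Act}\times\Sigma$; it is a modal transition system if $R^a\subseteq R^c$; a labelled transition system $(\Sigma,R)$ is identified with the modal transition system $(\Sigma,R,R)$. $M$ is image-finite if for all $s\in\Sigma$, $\alpha\in\mathrm{Act}$, $m\in\{a,c\}$ the set $\{s' : (s,\alpha,s')\in R^m\}$ is finite. A pointed system $(M,i)$ has a designated state $i$. A relation $Q\subseteq\Sigma\times\Sigma$ is a refinement within $M$ if $(s,t)\in Q$ implies, for all $\alpha$: (i) whenever $(s,\alpha,s')\in R^a$ there is $(t,\alpha,t')\in R^a$ with $(s',t')\in Q$; (ii) whenever $(t,\alpha,t')\in R^c$ there is $(s,\alpha,s')\in R^c$ with $(s',t')\in Q$. For pointed systems, $(N,j)$ refines $(M,i)$ if some refinement within the disjoint union of $M$ and $N$ contains $(i,j)$; they are refinement-equivalent if each refines the other. Domain theory: in a dcpo $D$, $k$ is compact if $k\le\bigvee A$ for directed $A$ implies $k\le a$ for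 some $a\in A$; $K(D)$ is the set of compact elements; $D$ is algebraic if every $d$ is the directed join of the compact elements below it. A bifinite (SFP) domain is an algebraic dcpo such that for every finite $F\subseteq K(D)$, the set obtained from $F$ by repeatedly taking sets of minimal upper bounds is finite and contained in $K(D)$, and every upper bound of $F$ lies above a minimal upper bound of $F$. The Scott topology consists of the sets $U$ with $U={\uparrow}(U\cap K(D))$; the Lawson topology is generated by the sets ${\uparrow}k\setminus{\uparrow}l$ with $k,l\in K(D)$. The mixed powerdomain $\mathcal{M}(D)$ consists of pairs $(L,U)$ with $L$ Scott-closed, $U$ a Lawson-closed upper set, and $L={\downarrow}(L\cap U)$, ordered by $(L,U)\le(L',U')$ iff $L\subseteq L'$ and $U'\subseteq U$. $\mathbb{D}$ is the initial solution over bifinite domains of $\mathbb{D}\cong\prod_{\alpha\in\mathrm{Act}}\mathcal{M}(\mathbb{D})$; write $d=((L^d_\alpha,U^d_\alpha))_{\alpha\in\mathrm{Act}}$. $\mathbb{D}$ is viewed as a mixed transition system $(\mathbb{D},\mathbb{R}^a,\mathbb{R}^c)$ with $(d,\alpha,d')\in\mathbb{R}^a$ iff $d'\in L^d_\alpha$ and $(d,\alpha,d')\in\mathbb{R}^c$ iff $d'\in U^d_\alpha$; its order coincides with the greatest refinement relation within this system. $\mathbb{X}=\max(\mathbb{D})$ is the set of maximal elements, with topology $\tau_{\mathbb{X}}=\{U\cap\mathbb{X} : U\text{ Scott-open}\}$. For every image-finite pointed modal transition system $(M,i)$ (in particular every image-finite pointed labelled transition system) there is a unique $[M,i]\in\mathbb{D}$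 such that $(\mathbb{D},[M,i])$ and $(M,i)$ are refinement-equivalent. Hennessy–Milner logic: $\varphi::=tt\mid\neg\varphi\mid\langle\alpha\rangle\varphi\mid\varphi\wedge\varphi$ ($\alpha\in\mathrm{Act}$); $[\alpha]\varphi:=\neg\langle\alpha\rangle\neg\varphi$, $\varphi\vee\psi:=\neg(\neg\varphi\wedge\neg\psi)$; finite conjunctions/disjunctions are iterated, empty conjunction is $tt$, empty disjunction is $\neg tt$. For a pointed mixed transition system $(N,i)$ and $m\in\{a,c\}$ (with $\neg a=c$, $\neg c=a$): $(N,i)\models^m tt$; $(N,i)\models^m\neg\varphi$ iff not $(N,i)\models^{\neg m}\varphi$; $(N,i)\models^m\langle\alpha\rangle\varphi$ iff $(N,i')\models^m\varphi$ for some $(i,\alpha,i')\in R^m$; $(N,i)\models^m\varphi\wedge\psi$ iff both hold. $[\![\varphi]\!]^m=\{d\in\mathbb{D} : (\mathbb{D},d)\models^m\varphi\}$. Process terms: $p::=\mathbf{0}\mid\bot\mid\alpha_{tt}.p\mid\alpha_\bot.p\mid p+p$, where neither summand of $+$ may be $\mathbf{0}$ or $\bot$. Transitions: $\bot\xrightarrow{\gamma}_\bot\bot$ for all $\gamma\in\mathrm{Act}$; $\alpha_{tt}.p\xrightarrow{\alpha}_{tt}p$; $\alpha_\bot.p\xrightarrow{\alpha}_\bot p$; if $p\xrightarrow{\alpha}_v p'$ then $p+q\xrightarrow{\alpha}_v p'$ and $q+p\xrightarrow{\alpha}_v p'$ ($v\in\{\bot,tt\}$); $\mathbf{0}$ has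 no transitions. Formulas: $\varphi_{\mathbf{0}}=\bigwedge_{\alpha}\neg\langle\alpha\rangle tt$; $\varphi_\bot=tt$; $\varphi_{\alpha_{tt}.p}=\langle\alpha\rangle\varphi_p\wedge[\alpha]\varphi_p\wedge\bigwedge_{\beta\ne\alpha}\neg\langle\beta\rangle tt$; $\varphi_{\alpha_\bot.p}=[\alpha]\varphi_p\wedge\bigwedge_{\beta\ne\alpha}\neg\langle\beta\rangle tt$; $\varphi_{p+q}=\bigwedge\{\langle\alpha\rangle\varphi_{r'} : \alpha\in\mathrm{Act},\ p+q\xrightarrow{\alpha}_{tt}r'\}\wedge\bigwedge_{\alpha\in\mathrm{Act}}[\alpha]\bigvee\{\varphi_{r'} : p+q\xrightarrow{\alpha}_v r',\ v\in\{\bot,tt\}\}$. For $w=\delta_1\cdots\delta_n\in\mathrm{Act}^*$, $\alpha\in\mathrm{Act}$ and a term $p$, let $\psi_{w,\alpha,p}=[\delta_1]\cdots[\delta_n](\langle\alpha\rangle\varphi_p\vee\neg\langle\alpha\rangle\varphi_p)$; $\Phi$ is the set of all such formulas and $C_\Phi=\bigcap_{\psi\in\Phi}[\![\psi]\!]^a$. *)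

(* Defs.v *)
From Stdlib Require List.
From mathcomp Require Import all_boot.
Set Implicit Arguments. Unset Strict Implicit. Unset Printing Implicit Defensive.

Section MixedDomain.
Variable Act : finType.

(* The initial solution D of D ~ prod_{a in Act} M(D), built as the     *)
(* standard bilimit of the finite approximants D_0 = {bot},            *)
(* D_{n+1} = Act -> M(D_n), along the projections p_0 = const,          *)
(* p_{n+1} = prod_a M(p_n).  In the finite poset D_n, Scott-closed sets *)
(* are the lower sets and Lawson-closed upper sets are the upper sets,  *)
(* so M(D_n) = {(L,U) | L lower, U upper, L = down(L cap U)}.           *)

Fixpoint car (n : nat) : Type :=
  match n with
  | 0 => unit
  | S m => Act -> ((car m -> Prop) * (car m -> Prop))
  end.

Definition le (n : nat) : car n -> car n -> Prop :=
  match n return car n -> car n -> Prop with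
  | 0 => fun _ _ => True
  | S m => fun f g => forall a : Act,
      (forall x, (f a).1 x -> (g a).1 x) /\ (forall x, (g a).2 x -> (f a).2 x)
  end.

Fixpoint good (n : nat) : car n -> Prop :=
  match n return car n -> Prop with
  | 0 => fun _ => True
  | S m => fun f => forall a : Act,
      (forall x, (f a).1 x -> @good m x) /\
      (forall x, (f a).2 x -> @good m x) /\
      (forall x y, @good m x -> @le m x y -> (f a).1 y -> (f a).1 x) /\
      (forall x y, @good m y -> @le m x y -> (f a).2 x -> (f a).2 y) /\
      (forall x, (f a).1 x -> exists y, (f a).1 y /\ (f a).2 y /\ @le m x y)
  end.

Fixpoint proj (n : nat) : car n.+1 -> car n :=
  match n return car n.+1 -> car n with
  | 0 => fun _ => tt
  | S m => fun f a =>
      ((fun y => @good m y /\ exists x, (f a).1 x /\ @le m y (@proj m x)),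
       (fun y => @good m y /\ exists x, (f a).2 x /\ @le m (@proj m x) y))
  end.

(* the bilimit D (elements up to the equivalence induced by the order) *)
Record Dom : Type := MkDom {
  dc : forall n, car n;
  dgood : forall n, good (dc n);
  dcoh : forall n, le (proj (dc n.+1)) (dc n) /\ le (dc n) (proj (dc n.+1))
}.

Definition Dle (d e : Dom) : Prop := forall n, le (dc d n) (dc e n).

(* transition structure of D, via the isomorphism D ~ prod_a M(D):
   L^d_a = {d' | forall n, pi_n d' in L-component of (pi_{n+1} d)(a)}, same for U *)
Definition DRa (d : Dom) (a : Act) (d' : Dom) : Prop :=
  forall n, ((dc d n.+1) a).1 (dc d' n).
Definition DRc (d : Dom) (a : Act) (d' : Dom) : Prop :=
  forall n, ((dc d n.+1) a).2 (dc d' n).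

Definition Dmax (d : Dom) : Prop := forall e, Dle d e -> Dle e d.

Inductive form : Type :=
| Ftt : form
| Fneg : form -> form
| Fdia : Act -> form -> form
| Fconj : form -> form -> form.

Definition Fbox (a : Act) (f : form) : form := Fneg (Fdia a (Fneg f)).
Definition Fdisj (f g : form) : form := Fneg (Fconj (Fneg f) (Fneg g)).

Fixpoint bigconj (l : seq form) : form :=
  match l with
  | [::] => Ftt
  | [:: f] => f
  | f :: l' => Fconj f (bigconj l')
  end.

Fixpoint bigdisj (l : seq form) : form :=
  match l with
  | [::] => Fneg Ftt
  | [:: f] => f
  | f :: l' => Fdisj f (bigdisj l')
  end.

(* m = true is the "a" (may/admissible) mode, m = false the "c" mode *)
Fixpoint sat (S : Type) (Ra Rc : S -> Act -> S -> Prop) (m : bool) (s : S)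
    (f : form) {struct f} : Prop :=
  match f with
  | Ftt => True
  | Fneg g => ~ sat Ra Rc (~~ m) s g
  | Fdia a g => exists s', (if m then Ra else Rc) s a s' /\ sat Ra Rc m s' g
  | Fconj g h => sat Ra Rc m s g /\ sat Ra Rc m s h
  end.

Inductive proc : Type :=
| P0 : proc
| Pbot : proc
| Ptt : Act -> proc -> proc
| Pbt : Act -> proc -> proc
| Psum : proc -> proc -> proc.

Fixpoint wfp (p : proc) : Prop :=
  match p with
  | Psum q r => wfp q /\ wfp r /\ q <> P0 /\ q <> Pbot /\ r <> P0 /\ r <> Pbot
  | Ptt _ q => wfp q
  | Pbt _ q => wfp q
  | _ => True
  end.

Definition notothers (a : Act) : form :=
  bigconj [seq Fneg (Fdia b Ftt) | b <- enum Act & b != a].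

(* phit p = (phi_p, list of transitions (label, v = tt?, phi of target)) *)
Fixpoint phit (p : proc) : form * seq (Act * bool * form) :=
  match p with
  | P0 => (bigconj [seq Fneg (Fdia a Ftt) | a <- enum Act], [::])
  | Pbot => (Ftt, [seq (g, false, Ftt) | g <- enum Act])
  | Ptt a q => let fq := (phit q).1 in
      (bigconj [:: Fdia a fq; Fbox a fq; notothers a], [:: (a, true, fq)])
  | Pbt a q => let fq := (phit q).1 in
      (bigconj [:: Fbox a fq; notothers a], [:: (a, false, fq)])
  | Psum q r => let T := (phit q).2 ++ (phit r).2 in
      (Fconj (bigconj [seq Fdia x.1.1 x.2 | x <- T & x.1.2])
             (bigconj [seq Fbox a (bigdisj [seq x.2 | x <- T & x.1.1 == a])
                      | a <- enum Act]), T)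
  end.

Definition phi (p : proc) : form := (phit p).1.

Definition psi (w : seq Act) (a : Act) (p : proc) : form :=
  foldr Fbox (Fdisj (Fdia a (phi p)) (Fneg (Fdia a (phi p)))) w.

Definition CPhi (d : Dom) : Prop :=
  forall w a p, wfp p -> sat DRa DRc true d (psi w a p).

Definition compact_el (k : Dom) : Prop :=
  forall A : Dom -> Prop,
    (exists x, A x) ->
    (forall x y, A x -> A y -> exists z, A z /\ Dle x z /\ Dle y z) ->
    forall s, (forall x, A x -> Dle x s) ->
      (forall u, (forall x, A x -> Dle x u) -> Dle s u) ->
      Dle k s -> exists x, A x /\ Dle k x.

Definition scott_open (U : Dom -> Prop) : Prop :=
  forall x, U x <-> exists k, compact_el k /\ U k /\ Dle k x.

Definition in_sub (x : Dom) (kl : Dom * Dom) : Prop :=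
  Dle kl.1 x /\ ~ Dle kl.2 x.

Definition lawson_open (O : Dom -> Prop) : Prop :=
  forall x, O x -> exists s : seq (Dom * Dom),
    (forall kl, List.In kl s -> compact_el kl.1 /\ compact_el kl.2 /\ in_sub x kl) /\
    (forall y, (forall kl, List.In kl s -> in_sub y kl) -> O y).

Definition lawson_closed (P : Dom -> Prop) : Prop :=
  lawson_open (fun x => ~ P x).

Definition X_open (V : Dom -> Prop) : Prop :=
  exists U, scott_open U /\ forall x, V x <-> (U x /\ Dmax x).

Definition X_compact : Prop :=
  forall (I : Type) (V : I -> Dom -> Prop),
    (forall i, X_open (V i)) ->
    (forall x, Dmax x -> exists i, V i x) ->
    exists s : seq I, forall x, Dmax x -> exists i, List.In i s /\ V i x.

(* points of D are identified up to the equivalence x <= y <= x *)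
Definition X_hausdorff : Prop :=
  forall x y, Dmax x -> Dmax y -> ~ (Dle x y /\ Dle y x) ->
    exists V W, X_open V /\ X_open W /\ V x /\ W y /\ forall z, ~ (V z /\ W z).

Definition X_zero_dim : Prop :=
  forall V x, X_open V -> V x ->
    exists C, X_open C /\ X_open (fun y => Dmax y /\ ~ C y) /\ C x /\
              forall y, C y -> V y.

Definition X_stone : Prop := X_compact /\ X_hausdorff /\ X_zero_dim.

End MixedDomain.

Definition sumR (Act : Type) (S1 S2 : Type) (R1 : S1 -> Act -> S1 -> Prop)
    (R2 : S2 -> Act -> S2 -> Prop) : (S1 + S2) -> Act -> (S1 + S2) -> Prop :=
  fun s a t => match s, t with
               | inl x, inl y => R1 x a y
               | inr x, inr y => R2 x a y
               | _, _ => False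
               end.

Definition is_refinement (Act : Type) (S : Type) (Ra Rc : S -> Act -> S -> Prop)
    (Q : S -> S -> Prop) : Prop :=
  forall s t, Q s t -> forall a,
    (forall s', Ra s a s' -> exists t', Ra t a t' /\ Q s' t') /\
    (forall t', Rc t a t' -> exists s', Rc s a s' /\ Q s' t').

(* (N, j) refines (M, i) *)
Definition refines (Act : Type) (S1 : Type) (Ra1 Rc1 : S1 -> Act -> S1 -> Prop) (i : S1)
    (S2 : Type) (Ra2 Rc2 : S2 -> Act -> S2 -> Prop) (j : S2) : Prop :=
  exists Q, is_refinement (sumR Ra1 Ra2) (sumR Rc1 Rc2) Q /\ Q (inl i) (inr j).

Definition ref_equiv (Act : Type) (S1 : Type) (Ra1 Rc1 : S1 -> Act -> S1 -> Prop) (i : S1)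
    (S2 : Type) (Ra2 Rc2 : S2 -> Act -> S2 -> Prop) (j : S2) : Prop :=
  refines Ra1 Rc1 i Ra2 Rc2 j /\ refines Ra2 Rc2 j Ra1 Rc1 i.

Definition image_finite_lts (Act : Type) (S : Type) (R : S -> Act -> S -> Prop) : Prop :=
  forall s a, exists l : seq S, forall s', R s a s' -> List.In s' l.

(* d = [L, l] for some pointed image-finite labelled transition system (L, l);
   (an LTS (S,R) is the modal transition system (S,R,R)) *)
Definition is_lts_point (Act : finType) (d : Dom Act) : Prop :=
  exists (S : Type) (R : S -> Act -> S -> Prop) (l : S),
    image_finite_lts R /\ ref_equiv R R l (@DRa Act) (@DRc Act) d.

Definition X_dense_lts (Act : finType) : Prop :=
  forall V : Dom Act -> Prop, X_open V -> (exists x, V x) ->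
    exists d, V d /\ is_lts_point d.

(* Main.v *)
Require Import Defs.
From mathcomp Require Import all_boot.
From mathcomp Require Import boolp.
Set Implicit Arguments. Unset Strict Implicit. Unset Printing Implicit Defensive.

(** The formula [phi p] of a process term describes a compact element: the
    states satisfying it in mode [a] form a principal upper set, and every
    compact element arises this way.  It is moreover [extendable]: a state
    satisfying [phi p] in mode [c] lies below one satisfying it in mode [a].
    Hence every state lies below one satisfying [<a>phi p \/ ~<a>phi p].  This
    density passes through boxes, by shrinking the upper sets of a state to
    the successors that already satisfy the given formula; so maximal states
    satisfy all [psi w a p].  Conversely, on [CPhi] every [c]-successor is an
    [a]-successor, and this leaves no room for a proper refinement.
    For the topology, each formula only depends on a finite approximation of a
    state, so [CPhi] is Lawson closed; compactness is then Koenig's lemma, and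
    at maximal points [phi p] holds in both modes or in neither, so it cuts out
    a clopen set.  For density, the finite approximants form a labelled
    transition system with transitions [L cap U], in which a state refines the
    compact element it comes from and denotes a maximal element. *)

(** * Types with finitely many elements, and a pigeonhole principle *)

Definition finitely_many (T : Type) : Prop :=
  exists (F : finType) (f : F -> T), forall x, exists i, f i = x.

Lemma finitely_many_pred (T : Type) :
  finitely_many T -> finitely_many (T -> Prop).
Proof.
move=> [F [f fP]]; exists {set F}, (fun (s : {set F}) x => exists2 i, i \in s & f i = x) => P.
exists [set i | `[< P (f i) >]]; apply: funext => x; apply: propext; split.
  by move=> [i]; rewrite inE => /asboolP Pi <-.
by move=> Px; have [i fi] := fP x; exists i; rewrite // inE fi; apply/asboolP.
Qed.

Lemma finitely_many_prod (T1 T2 : Type) :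
  finitely_many T1 -> finitely_many T2 -> finitely_many (T1 * T2).
Proof.
move=> [F [f fP]] [G [g gP]]; exists (F * G)%type, (fun u => (f u.1, g u.2)).
by move=> [x y]; have [i <-] := fP x; have [j <-] := gP y; exists (i, j).
Qed.

Lemma finitely_many_fun (A : finType) (T : Type) :
  finitely_many T -> finitely_many (A -> T).
Proof.
move=> [F [f fP]]; exists {ffun A -> F}, (fun (u : {ffun A -> F}) a => f (u a)) => x.
have [g gP] := choice (fun a => fP (x a)).
by exists [ffun a => g a]; apply: funext => a; rewrite ffunE.
Qed.

(** If the head fails at stage [N], it fails at all later stages, so from [N] on the witnesses lie
    in the tail. *)
Lemma list_pigeonhole (T : Type) (l : seq T) (P : nat -> T -> Prop) :
  (forall n t, P n.+1 t -> P n t) -> (forall n, exists t, List.In t l /\ P n t) ->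
  exists t, List.In t l /\ forall n, P n t.
Proof.
move=> PS; have Pge m n t : n <= m -> P m t -> P n t.
  by elim: m => [|m IH]; rewrite leq_eqVlt => /predU1P[-> //|//]; move=> nm /PS /IH; apply.
elim: l => [|x l IH] Pex; first by have [t []] := Pex 0.
have [Px|/existsNP[N nPx]] := EM (forall n, P n x); first by exists x; split=> //; left.
have [n|t [tl Pt]] := IH; last by exists t; split=> //; right.
have [t [[<-|tl] Pt]] := Pex (maxn n N).
  by case: nPx; apply: Pge Pt; apply: leq_maxr.
by exists t; split=> //; apply: Pge Pt; apply: leq_maxl.
Qed.

Lemma In_enum (T : finType) (t : T) : List.In t (enum T).
Proof.
have : t \in enum T by rewrite mem_enum.
elim: (enum T) => [//|y l IH]; rewrite inE => /predU1P[->|/IH]; by [left|right].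
Qed.

(** * Order and projections on the approximants *)

Section MixedDomain.
Variable Act : finType.
Implicit Types (n m : nat) (d e : Dom Act) (a : Act) (f g : form Act).

Lemma finitely_many_car n : finitely_many (car Act n).
Proof.
elim: n => [|n IH]; first by exists unit, id => x; exists x.
by apply: finitely_many_fun; apply: finitely_many_prod; apply: finitely_many_pred.
Qed.

Lemma le_refl n (k : car Act n) : le k k.
Proof. by case: n k. Qed.

Lemma le_trans n (k2 k1 k3 : car Act n) : le k1 k2 -> le k2 k3 -> le k1 k3.
Proof.
case: n k1 k2 k3 => [//|n] k1 k2 k3 h12 h23 a.
have [l12 u12] := h12 a; have [l23 u23] := h23 a.
by split=> x; [move=> /l12 /l23 | move=> /u23 /u12].
Qed.

(** Components are compared by extensionality, so the coherence condition of [Dom] becomes the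
    equation [proj_dc]. *)
Lemma le_anti n (k1 k2 : car Act n) : le k1 k2 -> le k2 k1 -> k1 = k2.
Proof.
case: n k1 k2 => [|n] k1 k2; first by case: k1; case: k2.
move=> h12 h21; apply: funext => a; have [l12 u12] := h12 a.
have [l21 u21] := h21 a; rewrite [k1 a]surjective_pairing [k2 a]surjective_pairing.
by congr pair; apply: funext => x; apply: propext; split; auto.
Qed.

Lemma proj_mono n (k1 k2 : car Act n.+1) : le k1 k2 -> le (proj k1) (proj k2).
Proof.
case: n k1 k2 => [//|n] k1 k2 h a; have [l u] := h a.
by split=> x [gx [y [ky xy]]]; split=> //; exists y; split; auto.
Qed.

Section GoodElements.
Variables (n : nat) (k : car Act n.+1) (a : Act).
Hypothesis gk : good k.

Lemma good_lower x : (k a).1 x -> good x.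
Proof. by have [h _] := gk a; apply: h. Qed.

Lemma good_upper x : (k a).2 x -> good x.
Proof. by have [_ [h _]] := gk a; apply: h. Qed.

Lemma lower_closed x y : good x -> le x y -> (k a).1 y -> (k a).1 x.
Proof. by have [_ [_ [h _]]] := gk a; apply: h. Qed.

Lemma upper_closed x y : good y -> le x y -> (k a).2 x -> (k a).2 y.
Proof. by have [_ [_ [_ [h _]]]] := gk a; apply: h. Qed.

Lemma lower_upper x : (k a).1 x -> exists y, (k a).1 y /\ (k a).2 y /\ le x y.
Proof. by have [_ [_ [_ [_ h]]]] := gk a; apply: h. Qed.

End GoodElements.

Lemma good_proj n (k : car Act n.+1) : good k -> good (proj k).
Proof.
elim: n k => [//|n IH] k gk a; split; first by move=> x [].
split; first by move=> x [].
split; first by move=> x y gx xy [_ [z [kz yz]]]; split=> //;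
  exists z; split=> //; apply: le_trans yz.
split; first by move=> x y gy xy [_ [z [kz zx]]]; split=> //;
  exists z; split=> //; apply: le_trans xy.
move=> x [gx [z [kz xz]]]; have [w [lw [uw zw]]] := lower_upper gk kz.
have gw := IH w (good_lower gk lw).
exists (proj w); split; first by split=> //; exists w; split=> //; apply: le_refl.
split; first by split=> //; exists w; split=> //; apply: le_refl.
by apply: le_trans xz _; apply: proj_mono.
Qed.

Lemma Dle_refl d : Dle d d.
Proof. by move=> n; apply: le_refl. Qed.

Lemma Dle_trans (y x z : Dom Act) : Dle x y -> Dle y z -> Dle x z.
Proof. by move=> xy yz n; apply: le_trans (xy n) (yz n). Qed.

Lemma proj_dc d n : proj (dc d n.+1) = dc d n.
Proof. by have [h1 h2] := dcoh d n; apply: le_anti. Qed.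

Lemma le_dc_down d e n m : n <= m -> le (dc d m) (dc e m) -> le (dc d n) (dc e n).
Proof.
elim: m => [|m IH]; rewrite leq_eqVlt => /predU1P[-> //|//] nm /proj_mono.
by rewrite !proj_dc; apply: IH.
Qed.

Lemma eq_dc_down d e n m : n <= m -> dc d m = dc e m -> dc d n = dc e n.
Proof.
by move=> nm de; apply: le_anti; apply: (le_dc_down nm); rewrite de; apply: le_refl.
Qed.

Lemma proj_lowerE n (k : car Act n.+2) a (y : car Act n) :
  (proj k a).1 y <-> good y /\ exists x : car Act n.+1, (k a).1 x /\ le y (proj x).
Proof. by []. Qed.

Lemma proj_upperE n (k : car Act n.+2) a (y : car Act n) :
  (proj k a).2 y <-> good y /\ exists x : car Act n.+1, (k a).2 x /\ le (proj x) y.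
Proof. by []. Qed.

Lemma mem_proj_lower n (k : car Act n.+2) a (x : car Act n.+1) : good k ->
  (k a).1 x -> ((proj k) a).1 (proj x).
Proof.
move=> gk kx; split; first exact: good_proj (good_lower gk kx).
by exists x; split=> //; apply: le_refl.
Qed.

Lemma mem_proj_upper n (k : car Act n.+2) a (x : car Act n.+1) : good k ->
  (k a).2 x -> ((proj k) a).2 (proj x).
Proof.
move=> gk kx; split; first exact: good_proj (good_upper gk kx).
by exists x; split=> //; apply: le_refl.
Qed.

Lemma lower_down d a e n m : n <= m ->
  ((dc d m.+1) a).1 (dc e m) -> ((dc d n.+1) a).1 (dc e n).
Proof.
elim: m => [|m IH]; rewrite leq_eqVlt => /predU1P[-> //|//] nm h; apply: IH => //.
by rewrite -(proj_dc d) -(proj_dc e); apply: mem_proj_lower (dgood d _) h.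
Qed.

Lemma upper_down d a e n m : n <= m ->
  ((dc d m.+1) a).2 (dc e m) -> ((dc d n.+1) a).2 (dc e n).
Proof.
elim: m => [|m IH]; rewrite leq_eqVlt => /predU1P[-> //|//] nm h; apply: IH => //.
by rewrite -(proj_dc d) -(proj_dc e); apply: mem_proj_upper (dgood d _) h.
Qed.

(** * Koenig's lemma for the inverse system of approximants *)

Section Konig.
Variable A : forall n, car Act n -> Prop.
Hypothesis A_ex : forall n, exists k : car Act n, A k.
Hypothesis A_good : forall n (k : car Act n), A k -> good k.
Hypothesis A_proj : forall n (k : car Act n.+1), A k -> A (proj k).

(** With [proj] as parent map the levels form a tree; the branch below runs through nodes that
    satisfy [extends j] for every [j]. *)
Fixpoint extends j n (k : car Act n) : Prop :=
  if j is i.+1 then exists2 y : car Act n.+1, @extends i n.+1 y & proj y = k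
  else A k.

Lemma extends_pred j n (k : car Act n) : extends j.+1 k -> extends j k.
Proof.
elim: j n k => [|j IH] n k; first by move=> [y Ay <-]; apply: A_proj.
by move=> [y /IH ey yk]; exists y.
Qed.

Lemma extends_ex j n : exists k : car Act n, extends j k.
Proof.
by elim: j n => [|j IH] n //; have [y ey] := IH n.+1; exists (proj y), y.
Qed.

(** Each level is finite and [extends] decreases in [j], so by pigeonhole one child serves all
    [j]. *)
Lemma extends_step n (k : car Act n) : (forall j, extends j k) ->
  exists y : car Act n.+1, (forall j, extends j y) /\ proj y = k.
Proof.
move=> ek; have [F [f fP]] := finitely_many_car n.+1.
have [||i [_ fi]] := @list_pigeonhole F (enum F)
    (fun j i => extends j (f i) /\ proj (f i) = k).
- by move=> j i [/extends_pred].
- move=> j; have [y ey yk] := ek j.+1; have [i fi] := fP y; exists i.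
  by rewrite fi; split=> //; apply: In_enum.
by exists (f i); split=> [j|]; [have [] := fi j | have [] := fi 0].
Qed.

Lemma extends_root j : extends j (tt : car Act 0).
Proof. by have [[]] := extends_ex j 0. Qed.

Fixpoint konig_branch n : {k : car Act n | forall j, extends j k} :=
  match n with
  | 0 => exist _ (tt : car Act 0) extends_root
  | m.+1 => let: exist k ek := konig_branch m in
            let: exist y (conj ey _) := cid (extends_step ek) in exist _ y ey
  end.

Lemma konig : exists d, forall n, A (dc d n).
Proof.
pose s n := sval (konig_branch n).
have sA n : A (s n) by apply: (svalP (konig_branch n) 0).
have sP n : proj (s n.+1) = s n.
  (* The type of [konig_branch] does not record that each node projects to the preceding one;
     unfolding one stage recovers it. *)
  by rewrite /s /=; case: (konig_branch n) => k ek; case: (cid _) => y [ey yk].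
have coh n : le (proj (s n.+1)) (s n) /\ le (s n) (proj (s n.+1)).
  by rewrite sP; split; apply: le_refl.
by exists (MkDom (fun n => A_good (sA n)) coh).
Qed.

End Konig.

(** * Interpretation of modal systems in D, and embedding of the approximants *)

Section ModalSemantics.
Variables (S : Type) (Ra Rc : S -> Act -> S -> Prop).

(** These are the finite approximations of the element $[M,s]$. *)
Fixpoint sem_car n : S -> car Act n :=
  match n with
  | 0 => fun _ => tt
  | m.+1 => fun s a =>
      ((fun y => good y /\ exists t, Ra s a t /\ le y (sem_car m t)),
       (fun y => good y /\ exists t, Rc s a t /\ le (sem_car m t) y))
  end.

Hypothesis modal : forall s a t, Ra s a t -> Rc s a t.

(** Modality gives the mixed condition: the image of an [Ra]-successor lies in both components. *)
Lemma good_sem_car n s : good (sem_car n s).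
Proof.
elim: n s => [//|n IH] s a; split; first by move=> x [].
split; first by move=> x [].
split; first by move=> x y gx xy [_ [t [st yt]]]; split=> //;
  exists t; split=> //; apply: le_trans yt.
split; first by move=> x y gy xy [_ [t [st tx]]]; split=> //;
  exists t; split=> //; apply: le_trans xy.
move=> x [gx [t [st xt]]]; exists (sem_car n t).
by split; [|split] => //; split=> //; exists t; split; auto; apply: le_refl.
Qed.

Lemma proj_sem_car n s : proj (sem_car n.+1 s) = sem_car n s.
Proof.
elim: n s => [//|n IH] s; apply: funext => a /=.
congr pair; apply: funext => y; apply: propext.
  split=> [[gy [x [[gx [t [st xt]]] yx]]]|[gy [t [st yt]]]]; split=> //.
    by exists t; split=> //; apply: le_trans yx _; rewrite -IH; apply: proj_mono.
  exists (sem_car n.+1 t); rewrite IH; split=> //; split; first exact: (good_sem_car n.+1 t).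
  by exists t; split=> //; apply: le_refl.
split=> [[gy [x [[gx [t [st xt]]] yx]]]|[gy [t [st yt]]]]; split=> //.
  by exists t; split=> //; apply: le_trans yx; rewrite -IH; apply: proj_mono.
exists (sem_car n.+1 t); rewrite IH; split=> //; split; first exact: (good_sem_car n.+1 t).
by exists t; split=> //; apply: le_refl.
Qed.

Lemma sem_coh s n : le (proj (sem_car n.+1 s)) (sem_car n s) /\
  le (sem_car n s) (proj (sem_car n.+1 s)).
Proof. by rewrite proj_sem_car; split; apply: le_refl. Qed.

Definition sem s : Dom Act := MkDom (fun n => good_sem_car n s) (sem_coh s).

End ModalSemantics.

(** The disjoint union of all approximants is a modal transition system whose
    interpretation is the embedding of each [D_n] into [D]; level [0] loops on
    itself in mode [c], so as to denote bottom. *)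
Definition level_state := {n & car Act n}.

Definition level_a (s : level_state) a (t : level_state) : Prop :=
  let: existT n k := s in
  match n return car Act n -> Prop with
  | 0 => fun _ => False
  | m.+1 => fun k => exists y, [/\ t = existT _ m y, (k a).1 y & (k a).2 y]
  end k.

Definition level_c (s : level_state) a (t : level_state) : Prop :=
  let: existT n k := s in
  match n return car Act n -> Prop with
  | 0 => fun _ => t = s
  | m.+1 => fun k => exists y, t = existT _ m y /\ (k a).2 y
  end k.

Lemma level_modal s a t : level_a s a t -> level_c s a t.
Proof. by case: s => [[|n] k] //= [y [-> _ ky]]; exists y. Qed.

Definition emb n (k : car Act n) : Dom Act := sem level_modal (existT _ n k).

(** [level_a] retains only the members of L cap U; since L = down(L cap U) for [good] elements,
    downward closure restores the rest of L. *)
Lemma dc_emb n (k : car Act n) : good k -> dc (emb k) n = k.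
Proof.
rewrite /=; elim: n k => [|n IH] k gk /=; first by case: k gk.
apply: funext => a; rewrite [k a]surjective_pairing.
congr pair; apply: funext => x; apply: propext; split.
- move=> [gx [t [[y [-> ly uy]]]]]; rewrite IH; last exact: (good_lower gk ly).
  by move=> xy; apply: lower_closed xy ly.
- move=> kx; split; first exact: (good_lower gk kx).
  have [y [ly [uy xy]]] := lower_upper gk kx; exists (existT _ n y).
  by split; [exists y | rewrite IH //; exact: (good_lower gk ly)].
- move=> [gx [t [[y [-> uy]]]]]; rewrite IH; last exact: (good_upper gk uy).
  by move=> yx; apply: upper_closed yx uy.
- move=> kx; have gx := good_upper gk kx; split=> //; exists (existT _ n x).
  by split; [exists x | rewrite IH //; apply: le_refl].
Qed.

(** * Successors in D and the order they determine *)

Lemma lower_lift d a n (k : car Act n) : ((dc d n.+1) a).1 k ->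
  exists e, DRa d a e /\ le k (dc e n).
Proof.
move=> dk; have gk := good_lower (dgood d _) dk.
(* One level up, [e] is replaced by the embedding of a member of the next lower component whose
   projection is above. The successive projections may grow, so they need not form a thread. *)
have up j : exists e, le k (dc e n) /\ ((dc d (j + n).+1) a).1 (dc e (j + n)).
  elim: j => [|j [e [ke de]]]; first by exists (emb k);
    rewrite dc_emb //; split=> //; apply: le_refl.
  move: de; rewrite -(proj_dc d) => /proj_lowerE[_ [z [dz ez]]]; exists (emb z).
  have gz := good_lower (dgood d (j + n).+2) dz; rewrite addSn dc_emb //; split=> //.
  apply: le_trans ke _; apply: (@le_dc_down _ _ _ (j + n)); first exact: leq_addl.
  by rewrite -(proj_dc (emb z)) dc_emb.
(* Koenig's lemma extracts a thread. Candidates at level [m] are given through elements of D, so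
   that the bound at level [n] makes sense for every [m]. *)
have [||m y [e [<- [ke de]]]|e eA] := @konig (fun m y =>
  exists e, dc e m = y /\ le k (dc e n) /\ ((dc d m.+1) a).1 y).
- move=> m; have [e [ke de]] := up m; exists (dc e m), e; split=> //; split=> //.
  by apply: lower_down de; apply: leq_addr.
- by move=> m y [e [<- _]]; apply: dgood.
- exists e; rewrite proj_dc; split=> //; split=> //.
  by apply: lower_down de.
exists e; split; first by move=> m; have [x [_ []]] := eA m.
by have [x [<- []]] := eA n.
Qed.

Lemma upper_lift d a n (k : car Act n) : ((dc d n.+1) a).2 k ->
  exists e, DRc d a e /\ le (dc e n) k.
Proof.
move=> dk; have gk := good_upper (dgood d _) dk.
have up j : exists e, le (dc e n) k /\ ((dc d (j + n).+1) a).2 (dc e (j + n)).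
  elim: j => [|j [e [ke de]]]; first by exists (emb k);
    rewrite dc_emb //; split=> //; apply: le_refl.
  move: de; rewrite -(proj_dc d) => /proj_upperE[_ [z [dz ez]]]; exists (emb z).
  have gz := good_upper (dgood d (j + n).+2) dz; rewrite addSn dc_emb //; split=> //.
  apply: le_trans ke; apply: (@le_dc_down _ _ _ (j + n)); first exact: leq_addl.
  by rewrite -(proj_dc (emb z)) dc_emb.
have [||m y [e [<- [ke de]]]|e eA] := @konig (fun m y =>
  exists e, dc e m = y /\ le (dc e n) k /\ ((dc d m.+1) a).2 y).
- move=> m; have [e [ke de]] := up m; exists (dc e m), e; split=> //; split=> //.
  by apply: upper_down de; apply: leq_addr.
- by move=> m y [e [<- _]]; apply: dgood.
- exists e; rewrite proj_dc; split=> //; split=> //.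
  by apply: upper_down de.
exists e; split; first by move=> m; have [x [_ []]] := eA m.
by have [x [<- []]] := eA n.
Qed.

Lemma DRc_upper d a (x y : Dom Act) : Dle x y -> DRc d a x -> DRc d a y.
Proof. by move=> xy dx n; apply: upper_closed (xy n) (dx n); apply: dgood. Qed.

Lemma DRa_le d e a (x : Dom Act) : Dle d e -> DRa d a x -> DRa e a x.
Proof. by move=> de dx n; have [h _] := de n.+1 a; apply: h. Qed.

Lemma DRc_le d e a (x : Dom Act) : Dle d e -> DRc e a x -> DRc d a x.
Proof. by move=> de ex n; have [_ h] := de n.+1 a; apply: h. Qed.

(** A member of a component at level [n.+1] lifts to a successor in D, is transferred there, and
    projects back. *)
Lemma Dle_DR d e : (forall a x, DRa d a x -> DRa e a x) ->
  (forall a x, DRc e a x -> DRc d a x) -> Dle d e.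
Proof.
move=> de ed [//|n] a; split=> k dk.
  have [x [/de ex kx]] := lower_lift dk.
  by apply: lower_closed kx (ex n); [apply: dgood | apply: good_lower dk; apply: dgood].
have [x [/ed dx xk]] := upper_lift dk.
by apply: upper_closed xk (dx n); [apply: dgood | apply: good_upper dk; apply: dgood].
Qed.

(** Koenig's lemma carries L = down(L cap U) from the approximants to D. *)
Lemma DRa_DRc d a (x : Dom Act) : DRa d a x ->
  exists y, [/\ DRa d a y, DRc d a y & Dle x y].
Proof.
move=> dx; have [||m y [ly [uy xy]]|e eA] := @konig (fun m y =>
  ((dc d m.+1) a).1 y /\ ((dc d m.+1) a).2 y /\ le (dc x m) y).
- by move=> m; apply: lower_upper (dx m); apply: dgood.
- by move=> m y [ly _]; apply: good_lower ly; apply: dgood.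
- rewrite -(proj_dc d) -(proj_dc x); split; [|split]; last exact: proj_mono.
    by apply: mem_proj_lower (dgood d m.+2) ly.
  by apply: mem_proj_upper (dgood d m.+2) uy.
by exists e; split=> n; have [? []] := eA n.
Qed.

(** A coinduction principle: a refinement [Q] between a system and D gives inequalities at each
    level, by induction on the level. *)
Lemma sem_le S (Ra Rc : S -> Act -> S -> Prop)
    (modal : forall s a t, Ra s a t -> Rc s a t) (Q : S -> Dom Act -> Prop) :
  (forall s d a t, Q s d -> Ra s a t -> exists2 e, DRa d a e & Q t e) ->
  (forall s d a e, Q s d -> DRc d a e -> exists2 t, Rc s a t & Q t e) ->
  forall s d, Q s d -> Dle (sem modal s) d.
Proof.
move=> Qa Qc s d sd n; elim: n s d sd => [//|n IH] s d sd a; split=> y.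
  move=> [gy [t [st yt]]]; have [e de te] := Qa _ _ _ _ sd st.
  apply: lower_closed (de n); [exact: dgood | by [] |].
  by apply: le_trans yt _; apply: IH.
move=> dy; split; first exact: (good_upper (dgood d n.+1) dy).
have [e [de ey]] := upper_lift dy; have [t st te] := Qc _ _ _ _ sd de.
by exists t; split=> //; apply: le_trans ey; apply: IH.
Qed.

(** [emb] is the lower adjoint of the projection to level [n]. The refinement compares each level
    state with an element of D at the level of that state. *)
Lemma emb_le n (k : car Act n) e : good k -> Dle (emb k) e <-> le k (dc e n).
Proof.
move=> gk; split=> [ke|ke]; first by have := ke n; rewrite dc_emb.
apply: (@sem_le _ _ _ level_modal
  (fun s e => good (projT2 s) /\ le (projT2 s) (dc e (projT1 s)))); last by [].
  move=> [[|m] j] d a t //= [gj kd] [y [-> ly uy]].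
  have [h _] := kd a; have [x [dx yx]] := lower_lift (h _ ly).
  by exists x => //=; split=> //; apply: (good_lower gj ly).
(* At level 0 the loop in mode [c] answers every transition of [d]. *)
move=> [[|m] j] d a x /= [gj kd] dx; first by exists (existT _ 0 j).
have [_ h] := kd a; exists (existT _ m (dc x m)) => /=.
  by exists (dc x m); split=> //; apply: h; apply: dx.
by split; [apply: dgood | apply: le_refl].
Qed.

(** * Hennessy-Milner logic on D *)

Notation satD := (sat (@DRa Act) (@DRc Act)).

(** The [N] constructed is the modal depth of [f]. Both modes are treated at once because negation
    exchanges them. *)
Lemma sat_finitary f : exists N, forall d e, le (dc d N) (dc e N) ->
  (satD true d f -> satD true e f) /\ (satD false e f -> satD false d f).
Proof.
elim: f => [|f [N IH]|a f [N IH]|f [N IHf] g [M IHg]] /=.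
- by exists 0.
- by exists N => d e /IH[h1 h2]; split=> h ?; apply: h; auto.
- exists N.+1 => d e de; have [l u] := de a; split=> -[x [dx xf]].
    have [y [ey xy]] := lower_lift (l _ (dx N)); exists y; split=> //.
    by have [h _] := IH _ _ xy; apply: h.
  have [y [dy yx]] := upper_lift (u _ (dx N)); exists y; split=> //.
  by have [_ h] := IH _ _ yx; apply: h.
- exists (maxn N M) => d e de.
  have [f1 f2] := IHf _ _ (le_dc_down (leq_maxl N M) de).
  have [g1 g2] := IHg _ _ (le_dc_down (leq_maxr N M) de).
  by split=> -[? ?]; auto.
Qed.

Lemma sat_mono d e f : Dle d e -> satD true d f -> satD true e f.
Proof. by move=> de; have [N h] := sat_finitary f; have [] := h d e (de N). Qed.

(** For diamonds, a [DRa]-successor lies below a successor of both kinds, and satisfaction in mode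
    [a] is monotone. *)
Lemma sat_a_c d f : satD true d f -> satD false d f.
Proof.
elim: f d => [|f IH|a f IH|f IHf g IHg] d //=.
- by move=> nf df; apply: nf; apply: IH.
- move=> [x [dx xf]]; have [y [_ dy xy]] := DRa_DRc dx.
  by exists y; split=> //; apply: IH; apply: sat_mono xf.
- by move=> [? ?]; auto.
Qed.

Definition DR (m : bool) := if m then @DRa Act else @DRc Act.

Lemma sat_box (m : bool) d a f :
  satD m d (Fbox a f) <-> forall x, DR (~~ m) d a x -> satD m x f.
Proof.
rewrite /= negbK; split=> [h x dx|h [x [dx nxf]]]; last by apply: nxf; apply: h.
by apply: contrapT => nxf; apply: h; exists x.
Qed.

Lemma sat_disj (m : bool) d f g :
  satD m d (Fdisj f g) <-> satD m d f \/ satD m d g.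
Proof.
rewrite /= negbK; split=> [h|]; last by move=> h [? ?]; case: h.
by apply: contrapT => /not_orP.
Qed.

Lemma sat_bigconj (m : bool) d l :
  satD m d (bigconj l) <-> forall f, List.In f l -> satD m d f.
Proof.
elim: l => [|f [|g l] IH]; first by split.
  by split=> [df h [<-|]|] //; apply; left.
have -> : bigconj [:: f, g & l] = Fconj f (bigconj (g :: l)) by [].
split=> [[df /IH dl] h [<-|]|dl]; auto.
by split; [apply: dl; left | apply/IH => h hl; apply: dl; right].
Qed.

Lemma sat_bigdisj (m : bool) d l :
  satD m d (bigdisj l) <-> exists f, List.In f l /\ satD m d f.
Proof.
elim: l => [|f [|g l] IH]; first by split=> [h|[f []]//]; case: h.
  by split=> [df|[h [[<-|]]]] //; exists f; split=> //; left.
have -> : bigdisj [:: f, g & l] = Fdisj f (bigdisj (g :: l)) by [].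
rewrite sat_disj IH; split=> [[df|[h [hl dh]]]|[h [[<-|hl] dh]]]; auto.
- by exists f; split=> //; left.
- by exists h; split=> //; right.
by right; exists h.
Qed.

Lemma In_map (A B : Type) (h : A -> B) l y :
  List.In y (map h l) <-> exists x, List.In x l /\ h x = y.
Proof.
elim: l => [|x l IH] /=; first by split=> [//|[x []]].
rewrite IH; split=> [[<-|[z [zl hz]]]|[z [[->|zl] hz]]]; auto.
- by exists x; auto.
- by exists z; auto.
by right; exists z.
Qed.

Lemma In_filter (A : Type) (p : pred A) l x :
  List.In x (filter p l) <-> List.In x l /\ p x.
Proof.
elim: l => [|y l IH] /=; first by split=> [//|[]].
case: ifP => py /=; rewrite IH.
  by split=> [[<-|[]]|[[->|] px]]; auto.
by split=> [[]|[[yx|] px]]; auto; move: px; rewrite -yx py.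
Qed.

Lemma In_cat (A : Type) (l1 l2 : seq A) x :
  List.In x (l1 ++ l2) <-> List.In x l1 \/ List.In x l2.
Proof. by elim: l1 => [|y l1 IH] /=; [split=> [|[]]; auto | rewrite IH or_assoc]. Qed.

Implicit Type T : seq (Act * bool * form Act).

(** The common shape of all the formulas [phi p], read off the transitions of
    [p]; negation swaps the modes, hence [DR (~~ m)] for the boxes. *)
Definition satT (m : bool) d T : Prop :=
  (forall a f, List.In (a, true, f) T -> satD m d (Fdia a f)) /\
  (forall a x, DR (~~ m) d a x ->
    exists v f, List.In (a, v, f) T /\ satD m x f).

Lemma sat_notothers (m : bool) d a :
  satD m d (notothers a) <-> forall b x, DR (~~ m) d b x -> b = a.
Proof.
rewrite sat_bigconj; split=> [h b x dx|h f /In_map[b [/In_filter[_ ba] <-]]].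
  apply: contrapT => /eqP ba; apply: (h (Fneg (Fdia b (@Ftt Act)))).
    by apply/In_map; exists b; split=> //; apply/In_filter; split=> //; apply: In_enum.
  by exists x.
by move=> [x [dx _]]; move/eqP: ba; apply; apply: h dx.
Qed.

Definition branches a T : form Act := bigdisj [seq t.2 | t <- T & t.1.1 == a].

Lemma sat_branches (m : bool) d a T :
  satD m d (branches a T) <-> exists v f, List.In (a, v, f) T /\ satD m d f.
Proof.
rewrite sat_bigdisj; split=> [[f [/In_map[[[b v] g] [/In_filter[bT /eqP /= ba] /= gf]] df]]|].
  by exists v, f; rewrite -ba -gf in df *.
move=> [v [f [fT df]]]; exists f; split=> //; apply/In_map; exists (a, v, f).
by split=> //; apply/In_filter; rewrite /= eqxx.
Qed.

(** The special formulas fit the general shape: without branches no move is allowed, as for [P0],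
    and the branches of [Pbot] to [Ftt] allow every move. *)
Lemma sat_phi (m : bool) d p : satD m d (phi p) <-> satT m d (phit p).2.
Proof.
case: p => [||a q|a q|q r].
- rewrite /phi sat_bigconj; split=> [h|[_ h] f /In_map[a [_ <-]] [x [dx _]]].
    split=> // a x dx; exfalso; apply: (h (Fneg (Fdia a (@Ftt Act)))); last by exists x.
    by apply/In_map; exists a; split=> //; apply: In_enum.
  by have [v [g []]] := h a x dx.
- split=> // _; split=> [a f /In_map[b [_ //]]|a x _].
  exists false, (@Ftt Act); split=> //; apply/In_map.
  by exists a; split=> //; apply: In_enum.
- change (satD m d (bigconj [:: Fdia a (phi q); Fbox a (phi q); notothers a])
    <-> satT m d [:: (a, true, phi q)]).
  rewrite sat_bigconj; split=> [h|[h1 h2] f].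
    have /sat_box hb : satD m d (Fbox a (phi q)) by apply: h; right; left.
    have /sat_notothers hn : satD m d (notothers a) by apply: h; right; right; left.
    split=> [b f [[<- <-]|//]|b x dx]; first by apply: h; left.
    have ba := hn _ _ dx; rewrite ba in dx *.
    by exists true, (phi q); split; [left | apply: hb].
  case=> [<-|[<-|[<-|//]]]; first by apply: h1; left.
    by apply/sat_box => x /h2[v [g [[[_ <-]|//]]]].
  by apply/sat_notothers => b x /h2[v [g [[[-> _ _]|//]]]].
- change (satD m d (bigconj [:: Fbox a (phi q); notothers a])
    <-> satT m d [:: (a, false, phi q)]).
  rewrite sat_bigconj; split=> [h|[h1 h2] f].
    have /sat_box hb : satD m d (Fbox a (phi q)) by apply: h; left.
    have /sat_notothers hn : satD m d (notothers a) by apply: h; right; left.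
    split=> [b f [//|//]|b x dx].
    have ba := hn _ _ dx; rewrite ba in dx *.
    by exists false, (phi q); split; [left | apply: hb].
  case=> [<-|[<-|//]].
    by apply/sat_box => x /h2[v [g [[[_ <-]|//]]]].
  by apply/sat_notothers => b x /h2[v [g [[[-> _ _]|//]]]].
set T := (phit (Psum q r)).2.
change (satD m d (bigconj [seq Fdia x.1.1 x.2 | x <- T & x.1.2]) /\
  satD m d (bigconj [seq Fbox a (branches a T) | a <- enum Act])
  <-> satT m d T).
rewrite !sat_bigconj; split=> [[h1 h2]|[h1 h2]]; split.
- move=> a f af; apply: h1; apply/In_map; exists (a, true, f).
  by split=> //; apply/In_filter.
- move=> a x dx; have /sat_box/(_ x dx)/sat_branches : satD m d (Fbox a (branches a T)).
    by apply: h2; apply/In_map; exists a; split=> //; apply: In_enum.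
  by [].
- by move=> f /In_map[[[b v] g] [/In_filter[bT /= bv] <-]]; apply: h1; rewrite bv in bT.
by move=> f /In_map[a [_ <-]]; apply/sat_box => x /h2 xT; apply/sat_branches.
Qed.

(** Lawson-closed upper sets. *)
Definition upper_closed_set (U : Dom Act -> Prop) : Prop :=
  forall e, (forall n, exists x, U x /\ le (dc x n) (dc e n)) -> U e.

Lemma upper_closed_DRc d a : upper_closed_set (DRc d a).
Proof.
move=> e h n; have [x [dx xe]] := h n.
by apply: upper_closed xe (dx n); apply: dgood.
Qed.

Lemma upper_closed_sat U f : upper_closed_set U ->
  upper_closed_set (fun x => U x /\ satD true x f).
Proof.
move=> Uc e h; split.
  by apply: Uc => n; have [x [[Ux _] xe]] := h n; exists x.
have [N Nf] := sat_finitary f; have [x [[_ xf] xe]] := h N.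
by have [h1 _] := Nf _ _ xe; apply: h1.
Qed.

(** * Elements of D built from families of upper sets *)

Section DomOfUpperSets.
Variable U : Act -> Dom Act -> Prop.

Definition upper_car n : car Act n :=
  match n with
  | 0 => tt
  | m.+1 => fun a =>
      ((fun k => good k /\ exists x, U a x /\ le k (dc x m)),
       (fun k => good k /\ exists x, U a x /\ le (dc x m) k))
  end.

Lemma good_upper_car n : good (upper_car n).
Proof.
case: n => [//|n] a; split; first by move=> x [].
split; first by move=> x [].
split; first by move=> x y gx xy [_ [t [st yt]]]; split=> //;
  exists t; split=> //; apply: le_trans yt.
split; first by move=> x y gy xy [_ [t [st tx]]]; split=> //;
  exists t; split=> //; apply: le_trans xy.
move=> x [gx [t [st xt]]]; exists (dc t n).
by split; [|split] => //; (split; first exact: dgood) => //; exists t; split=> //; apply: le_refl.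
Qed.

Lemma proj_upper_car n : proj (upper_car n.+1) = upper_car n.
Proof.
case: n => [//|n]; apply: funext => a /=.
congr pair; apply: funext => y; apply: propext.
  split=> [[gy [x [[gx [t [st xt]]] yx]]]|[gy [t [st yt]]]]; split=> //.
    by exists t; split=> //; apply: le_trans yx _; rewrite -proj_dc; apply: proj_mono.
  exists (dc t n.+1); rewrite proj_dc; split=> //; split; first exact: (dgood t n.+1).
  by exists t; split=> //; apply: le_refl.
split=> [[gy [x [[gx [t [st xt]]] yx]]]|[gy [t [st yt]]]]; split=> //.
  by exists t; split=> //; apply: le_trans yx; rewrite -proj_dc; apply: proj_mono.
exists (dc t n.+1); rewrite proj_dc; split=> //; split; first exact: (dgood t n.+1).
by exists t; split=> //; apply: le_refl.
Qed.

(** The element has components (down U, U). Closedness recovers U from its projections, and Koenig's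
    lemma merges the bounds of [x] at each level into one [y] in U. *)
Lemma dom_of_upper_sets : (forall a, upper_closed_set (U a)) ->
  exists d, (forall a x, DRc d a x <-> U a x) /\
            (forall a x, DRa d a x <-> exists y, U a y /\ Dle x y).
Proof.
move=> Uc; have coh n : le (proj (upper_car n.+1)) (upper_car n) /\
    le (upper_car n) (proj (upper_car n.+1)).
  by rewrite proj_upper_car; split; apply: le_refl.
exists (MkDom good_upper_car coh); split=> a x.
  split=> [dx|Ux n]; first by apply: Uc => n; have [_] := dx n.
  by split; [apply: dgood | exists x; split=> //; apply: le_refl].
split=> [dx|[y [Uy xy]] n]; last by split; [apply: dgood | exists y].
have [||m y [z [Uz [<- xz]]]|y yA] := @konig (fun m y =>
  exists z, U a z /\ dc z m = y /\ le (dc x m) y).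
- by move=> m; have [_ [z [Uz xz]]] := dx m; exists (dc z m), z.
- by move=> m y [z [_ [<- _]]]; apply: dgood.
- exists z; rewrite proj_dc; split=> //; split=> //.
  by apply: le_dc_down xz; apply: leqnSn.
exists y; split; last by move=> n; have [z [_ []]] := yA n.
by apply: Uc => n; have [z [Uz [<- _]]] := yA n; exists z; split=> //; apply: le_refl.
Qed.

End DomOfUpperSets.

(** The upper components are cut down by [P], and the lower ones become the downward closures of
    what is left. By hypothesis these still contain the old lower components, so [e] is above
    [d]. *)
Lemma dom_restrict d (P : Act -> form Act) :
  (forall a x, DRa d a x -> exists y, [/\ Dle x y, DRc d a y & satD true y (P a)]) ->
  exists e, [/\ Dle d e,
    forall a x, DRc e a x <-> DRc d a x /\ satD true x (P a) &
    forall a x, DRc d a x -> satD true x (P a) -> DRa e a x].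
Proof.
move=> dP; have [|e [ec ea]] := @dom_of_upper_sets (fun a x => DRc d a x /\ satD true x (P a)).
  by move=> a; apply: upper_closed_sat; apply: upper_closed_DRc.
exists e; split=> //; last by move=> a x dx xP; apply/ea; exists x; split=> //; apply: Dle_refl.
apply: Dle_DR => a x; last by move=> /ec[].
by move=> /dP[y [xy dy yP]]; apply/ea; exists y.
Qed.

(** * Extendable and dense formulas *)

Definition extendable f : Prop :=
  forall d, satD false d f -> exists e, Dle d e /\ satD true e f.

(** Only the [DRc]-successors that satisfy some branch in mode [a] are kept. In mode [c] the boxes
    speak about [DRa]-successors; each lies below one that is also a [DRc]-successor, and that one
    extends to a kept element. Witnesses of diamonds extend likewise. *)
Lemma extendable_satT T : (forall t, List.In t T -> extendable t.2) ->
  forall d, satT false d T -> exists e, Dle d e /\ satT true e T.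
Proof.
move=> Text d [dT Td]; have [a x dx|e [de ec ea]] := @dom_restrict d (branches^~ T).
  have [y [ly uy xy]] := DRa_DRc dx; have [v [f [fT yf]]] := Td a y ly.
  have [z [yz zf]] := Text _ fT _ yf; exists z; split; first exact: Dle_trans yz.
    exact: DRc_upper uy.
  by apply/sat_branches; exists v, f.
exists e; split=> //; split=> [a f fT|a x /ec[_ /sat_branches //]].
have [x [dx xf]] := dT a f fT; have [y [xy yf]] := Text _ fT _ xf.
exists y; split=> //; apply: ea; first exact: DRc_upper dx.
by apply/sat_branches; exists true, f.
Qed.

Lemma extendable_phi p : extendable (phi p).
Proof.
(* The induction follows the branches, since the formula of a sum is built from the branches of the
   summands and not from their formulas. *)
suff [] : extendable (phi p) /\ (forall t, List.In t (phit p).2 -> extendable t.2) by [].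
have step q : (forall t, List.In t (phit q).2 -> extendable t.2) -> extendable (phi q).
  by move=> qT d /sat_phi/(extendable_satT qT)[e [de eT]]; exists e; split=> //; apply/sat_phi.
elim: p => [||a q [IH _]|a q [IH _]|q [_ IHq] r [_ IHr]]; split.
- exact: step.
- by [].
- by move=> d _; exists d; split=> //; apply: Dle_refl.
- by move=> t /In_map[a [_ <-]] d _; exists d; split=> //; apply: Dle_refl.
- by apply: step => t [<-|].
- by move=> t [<-|].
- by apply: step => t [<-|].
- by move=> t [<-|].
- by apply: step => t /In_cat[/IHq|/IHr].
- by move=> t /In_cat[/IHq|/IHr].
Qed.

Lemma extendable_dia a f : extendable f -> extendable (Fdia a f).
Proof.
(* Restriction by [Ftt] keeps the upper components and turns every [DRc]-successor into a
   [DRa]-successor. *)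
move=> fext d [x [dx xf]]; have [b y dy|e [de ec ea]] := @dom_restrict d (fun=> @Ftt Act).
  by have [z [_ uz yz]] := DRa_DRc dy; exists z.
have [y [xy yf]] := fext _ xf; exists e; split=> //; exists y; split=> //.
by apply: ea => //; apply: DRc_upper dx.
Qed.

Definition dense_form f : Prop := forall d, exists e, Dle d e /\ satD true e f.

Lemma dense_box a f : dense_form f -> dense_form (Fbox a f).
Proof.
move=> fd d; have [b x dx|e [de ec ea]] :=
    @dom_restrict d (fun b => if b == a then f else @Ftt Act).
  have [y [_ uy xy]] := DRa_DRc dx; have [z [yz zf]] := fd y; exists z.
  by split; [apply: Dle_trans yz | apply: DRc_upper uy | case: ifP].
exists e; split=> //; apply/sat_box => x /ec[_]; by rewrite eqxx.
Qed.

Lemma dense_psi w a p : dense_form (psi w a p).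
Proof.
elim: w => [|b w IH]; last exact: dense_box.
(* The case distinction is on mode [c], whose failure is the truth of the negation in mode [a]. *)
move=> d; have [df|ndf] := EM (satD false d (Fdia a (phi p))).
  have [e [de ef]] := extendable_dia (@extendable_phi p) df.
  by exists e; split=> //; apply/sat_disj; left.
by exists d; split; [apply: Dle_refl | apply/sat_disj; right].
Qed.

Lemma max_sat_dense d f : Dmax d -> dense_form f -> satD true d f.
Proof. by move=> dm fd; have [e [de ef]] := fd d; apply: sat_mono ef; apply: dm. Qed.

Lemma max_sat_extendable d f : Dmax d -> extendable f -> satD false d f -> satD true d f.
Proof. by move=> dm fe /fe[e [de ef]]; apply: sat_mono ef; apply: dm. Qed.

(** * Process terms for compact elements *)

Fixpoint psum (l : seq (proc Act)) : proc Act :=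
  match l with
  | [::] => @P0 Act
  | [:: p] => p
  | p :: l' => Psum p (psum l')
  end.

Definition prefixed (p : proc Act) : Prop :=
  match p with Ptt _ _ | Pbt _ _ => True | _ => False end.

(** Neither a prefix nor a nonempty sum of prefixes is [P0] or [Pbot], as [wfp] demands of
    summands. *)
Lemma wfp_psum l : (forall p, List.In p l -> wfp p /\ prefixed p) -> wfp (psum l).
Proof.
elim: l => [//|p [|q l] IH] lP; first by have [] := lP p (or_introl erefl).
have [wp pp] := lP p (or_introl erefl).
have wl : wfp (psum (q :: l)) by apply: IH => r rl; apply: lP; right.
split=> //; split=> //; split; first by move=> p0; rewrite p0 in pp.
split; first by move=> p0; rewrite p0 in pp.
have [_ qp] : wfp q /\ prefixed q by apply: lP; right; left.
by case: l {IH lP wl} => [|r l]; split=> // q0; rewrite /= in q0; rewrite q0 in qp.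
Qed.

Lemma transitions_psum l t : List.In t (phit (psum l)).2 <->
  exists p, List.In p l /\ List.In t (phit p).2.
Proof.
elim: l => [|p [|q l] IH]; first by split=> // -[p []].
  by split=> [h|[r [[<-|]]]] //; exists p; split=> //; left.
change (List.In t ((phit p).2 ++ (phit (psum (q :: l))).2) <->
  exists r, List.In r [:: p, q & l] /\ List.In t (phit r).2).
rewrite In_cat IH; split=> [[h|[r [rl rt]]]|[r [[<-|rl] rt]]]; auto.
- by exists p; split=> //; left.
- by exists r; split=> //; right.
by right; exists r.
Qed.

(** The term is a sum with a [Ptt] prefix for each member of L cap U and a [Pbt] prefix for each
    member of U. Its diamonds put L cap U, hence L, into the lower component of [e]; its boxes put
    every [DRc]-successor of [e] above a member of U. *)
Lemma phi_above n (k : car Act n) : good k ->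
  exists p, wfp p /\ forall e, satD true e (phi p) <-> le k (dc e n).
Proof.
elim: n k => [|n IH] k gk; first by exists (@Pbot Act).
have [F [g gP]] := finitely_many_car n.
have [|pr prP] := @choice F (proc Act) (fun i p => good (g i) ->
    wfp p /\ forall e, satD true e (phi p) <-> le (g i) (dc e n)).
  move=> i; have [/IH[p pP]|ngi] := EM (good (g i)); first by exists p.
  (* A default for values that are not [good]; these occur in no component of [k]. *)
  by exists (@P0 Act).
pose l := [seq Ptt t.1 (pr t.2) | t <- enum {: Act * F}
             & `[< (k t.1).1 (g t.2) /\ (k t.1).2 (g t.2) >]]
       ++ [seq Pbt t.1 (pr t.2) | t <- enum {: Act * F} & `[< (k t.1).2 (g t.2) >]].
have lP p : List.In p l <-> exists a i, (k a).2 (g i) /\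
    (p = Pbt a (pr i) \/ (k a).1 (g i) /\ p = Ptt a (pr i)).
  rewrite In_cat !In_map; split.
    case=> -[[a i] [/In_filter[_ /asboolP /= kai] <-]]; exists a, i.
      by case: kai => l1 u1; split=> //; right.
    by split=> //; left.
  move=> [a [i [ui [->|[li ->]]]]]; [right|left]; exists (a, i); split=> //;
    apply/In_filter; (split; first exact: In_enum); exact/asboolP.
have lT a v f : List.In (a, v, f) (phit (psum l)).2 <->
    exists i, [/\ (k a).2 (g i), f = phi (pr i) & v -> (k a).1 (g i)].
  rewrite transitions_psum; split.
    by move=> [p [/lP[b [i [ui [->|[li ->]]]]]]] [[<- <- <-]|//]; exists i.
  move=> [i [ui -> vi]]; exists (if v then Ptt a (pr i) else Pbt a (pr i)).
  split; last by case: (v); left.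
  by apply/lP; exists a, i; split=> //; case: v vi => vi; [right; split=> //; apply: vi | left].
exists (psum l); split.
  apply: wfp_psum => p /lP[a [i [ui pP]]].
  have [wi _] := prP i (good_upper gk ui).
  by case: pP => [->|[_ ->]].
have satP a i e : (k a).2 (g i) -> satD true e (phi (pr i)) <-> le (g i) (dc e n).
  by move=> /(good_upper gk)/prP[_]; apply.
move=> e; rewrite sat_phi; split=> [[eT Te] a|ke].
  split=> x xk.
    have [y [ly [uy xy]]] := lower_upper gk xk; have [i gi] := gP y; rewrite -gi in uy xy.
    have [z [ez /(satP a i z uy) zi]] : satD true e (Fdia a (phi (pr i))).
      by apply: eT; apply/lT; exists i; rewrite gi in uy *.
    apply: lower_closed (ez n); [exact: dgood | exact: (good_lower gk xk) |].
    exact: le_trans xy zi.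
  have [y [ey yx]] := upper_lift xk.
  have [v [f [/lT[i [ui -> _]] /(satP a i y ui) yi]]] := Te a y ey.
  apply: (upper_closed gk _ _ ui); first exact: (good_upper (dgood e n.+1) xk).
  exact: le_trans yi yx.
split=> [a f /lT[i [ui -> /(_ isT) li]]|a x ex].
  have [h _] := ke a; have [x [ex ix]] := lower_lift (h _ li); exists x; split=> //.
  exact/(satP a).
have [_ h] := ke a; have ux := h _ (ex n); have [i gi] := gP (dc x n); rewrite -gi in ux.
exists false, (phi (pr i)); split; first by apply/lT; exists i.
by apply/(satP a) => //; rewrite gi; apply: le_refl.
Qed.

(** * Maximal elements and [CPhi] *)

Lemma CPhi_step d a (x : Dom Act) : CPhi d -> DRc d a x -> CPhi x.
Proof.
by move=> dC dx w b p wp; have /sat_box := dC (a :: w) b p wp; apply.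
Qed.

(** Let [p] describe the projection of [x] to level [n]. Either some [DRa]-successor lies above this
    projection and downward closure applies, or the negated diamond holds, which [x] itself
    refutes. *)
Lemma CPhi_DRc_DRa d a (x : Dom Act) : CPhi d -> DRc d a x -> DRa d a x.
Proof.
move=> dC dx n; have [p [wp pP]] := phi_above (dgood x n).
have /sat_disj[[y [dy /pP xy]]|] := dC [::] a p wp.
  by apply: lower_closed xy (dy n); apply: dgood.
case; exists x; split=> //; apply: sat_a_c; apply/pP; exact: le_refl.
Qed.

(** A [DRa]-successor of [e] lies below a [DRc]-successor of [e], which is a successor of [d] of
    both kinds. Conversely a [DRc]-successor of [d] is a [DRa]-successor of [e], so it lies below a
    [DRc]-successor of [e], and induction reverses this inequality one level down. *)
Lemma CPhi_max d : CPhi d -> Dmax d.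
Proof.
move=> dC e de n; elim: n d e dC de => [//|n IH] d e dC de a; split=> x xP.
  have [y [ey xy]] := lower_lift xP; have [z [_ ez yz]] := DRa_DRc ey.
  have dz := CPhi_DRc_DRa dC (DRc_le de ez).
  apply: lower_closed (dz n); [exact: dgood | exact: (good_lower (dgood e n.+1) xP) |].
  by apply: le_trans xy (yz n).
have [y [dy yx]] := upper_lift xP.
have [z [_ ez yz]] := DRa_DRc (DRa_le de (CPhi_DRc_DRa dC dy)).
apply: upper_closed (ez n); [exact: dgood | exact: (good_upper (dgood d n.+1) xP) |].
by apply: le_trans yx; apply: IH yz; apply: CPhi_step dy.
Qed.

Lemma max_CPhi d : Dmax d <-> CPhi d.
Proof.
by split=> [dm w a p _|]; [apply: max_sat_dense dm _; apply: dense_psi | apply: CPhi_max].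
Qed.

(** * Compact elements and Scott-open sets *)

Lemma directed_level_max (A : Dom Act -> Prop) n : (exists x, A x) ->
  (forall x y, A x -> A y -> exists z, A z /\ Dle x z /\ Dle y z) ->
  exists x, A x /\ forall y, A y -> le (dc y n) (dc x n).
Proof.
move=> [x0 Ax0] Adir; have [F [g gP]] := finitely_many_car n.
(* The finitely many values at level [n] are treated one by one, moving up in [A] whenever a value
   is attained. *)
suff [x Ax xP] : exists2 x, A x &
    forall i, i \in enum F -> forall y, A y -> dc y n = g i -> le (g i) (dc x n).
  exists x; split=> // y Ay; have [i gi] := gP (dc y n).
  by rewrite -gi; apply: (xP i _ y) => //; rewrite mem_enum.
elim: (enum F) => [|i l [x Ax xP]]; first by exists x0.
have [[y [Ay yi]]|nyi] := EM (exists y, A y /\ dc y n = g i).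
  have [z [Az [xz yz]]] := Adir _ _ Ax Ay; exists z => // j.
  rewrite inE => /predU1P[->|jl] u Au uj; first by rewrite -yi; apply: yz.
  by apply: le_trans (xz n); apply: xP uj.
exists x => // j; rewrite inE => /predU1P[->|jl] u Au uj; last exact: xP uj.
by case: nyi; exists u.
Qed.

(** The greatest values of [A] at each level form an element of D above [A], hence above [s]; at
    level [n] that value is attained in [A]. *)
Lemma compact_emb n (k : car Act n) : good k -> compact_el (emb k).
Proof.
move=> gk A A0 Adir s _ slub /(emb_le _ gk) ks.
have [u uP] := choice (fun m => directed_level_max m A0 Adir).
have umax m y : A y -> le (dc y m) (dc (u m) m) by have [_] := uP m; apply.
have coh m : le (proj (dc (u m.+1) m.+1)) (dc (u m) m) /\
    le (dc (u m) m) (proj (dc (u m.+1) m.+1)).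
  rewrite proj_dc; split; first by apply: umax; have [] := uP m.+1.
  by apply: (@le_dc_down _ _ m m.+1) => //; apply: umax; have [] := uP m.
have su := slub (MkDom (fun m => dgood (u m) m) coh) (fun x Ax m => umax m x Ax).
by exists (u n); split; [have [] := uP n | apply/emb_le => //; apply: le_trans ks (su n)].
Qed.

Lemma le_emb_dc m n d : n <= m -> Dle (emb (dc d n)) (emb (dc d m)).
Proof.
move=> nm; apply/emb_le; first exact: dgood.
by rewrite (@eq_dc_down (emb (dc d m)) d n m) //; [apply: le_refl | apply: dc_emb; apply: dgood].
Qed.

(** [k] is the directed join of its embedded projections, and compactness stops at one of them. *)
Lemma compact_le_emb (k : Dom Act) : compact_el k -> exists n, Dle k (emb (dc k n)).
Proof.
move=> kc; have [|x y [n ->] [m ->]|x [n ->]|u uP||x [[n ->] kn]] :=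
    kc (fun x => exists n, x = emb (dc k n)) _ _ k.
- by exists (emb (dc k 0)), 0.
- exists (emb (dc k (maxn n m))); split; first by exists (maxn n m).
  by split; apply: le_emb_dc; [apply: leq_maxl | apply: leq_maxr].
- by apply/emb_le; [apply: dgood | apply: le_refl].
- by move=> n; apply/emb_le; [apply: dgood | apply: uP; exists n].
- exact: Dle_refl.
by exists n.
Qed.

Lemma scott_open_level (U : Dom Act -> Prop) (x : Dom Act) :
  scott_open U -> U x -> exists n, forall y, le (dc x n) (dc y n) -> U y.
Proof.
move=> Uo /Uo[k [kc [Uk kx]]]; have [n kn] := compact_le_emb kc; exists n => y xy.
apply/Uo; exists k; split=> //; split=> //; apply: Dle_trans kn _.
by apply/emb_le; [apply: dgood | apply: le_trans xy; apply: kx].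
Qed.

Lemma scott_open_finitary (U : Dom Act -> Prop) N :
  (forall x y, le (dc x N) (dc y N) -> U x -> U y) -> scott_open U.
Proof.
move=> UN x; split=> [Ux|[k [kc [Uk kx]]]]; last exact: UN (kx N) Uk.
exists (emb (dc x N)); split; first by apply: compact_emb; apply: dgood.
split; last by apply/emb_le; [apply: dgood | apply: le_refl].
by apply: UN Ux; rewrite dc_emb; [apply: le_refl | apply: dgood].
Qed.

(** * Topology of the space of maximal elements *)

Lemma X_open_sat f : X_open (fun x => satD true x f /\ Dmax x).
Proof.
exists (fun x => satD true x f); split=> //; have [N Nf] := sat_finitary f.
by apply: (@scott_open_finitary _ N) => x y /Nf[].
Qed.

Lemma lawson_closed_max : lawson_closed (@Dmax Act).
Proof.
move=> x nx; have [w [a [p [wp npsi]]]] : exists w a p, wfp p /\ ~ satD true x (psi w a p).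
  apply: contrapT => h; apply: nx; apply/max_CPhi => w a p wp.
  by apply: contrapT => np; apply: h; exists w, a, p.
have [N Nf] := sat_finitary (psi w a p); have [F [g gP]] := finitely_many_car N.
have good0 : good (tt : car Act 0) by [].
(* Avoiding the upper sets of all [k] not below [dc x N] forces [dc y N] below [dc x N], so
   [psi w a p] fails at [y] too. The first components are bottom and impose nothing. *)
exists [seq (emb (tt : car Act 0), emb (g i)) |
         i <- enum F & `[< good (g i) /\ ~ le (g i) (dc x N) >]].
split=> [kl /In_map[i [/In_filter[_ /asboolP[gi nix]] <-]]|y yP ymax].
  split; first exact: compact_emb; split; first exact: compact_emb.
  by split; [apply/emb_le | move/emb_le => /(_ gi)].
apply: npsi; have [|h _] := Nf y x; last by apply: h; move/max_CPhi: ymax; apply.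
apply: contrapT => nyx; have [i gi] := gP (dc y N).
have [|_] := yP (emb (tt : car Act 0), emb (g i)).
  apply/In_map; exists i; split=> //; apply/In_filter; split; first exact: In_enum.
  by apply/asboolP; rewrite gi; split=> //; apply: dgood.
by apply; apply/emb_le; rewrite /= gi; [apply: dgood | apply: le_refl].
Qed.

(** If every level had a bad point, Koenig's lemma would give a thread [e] of such points. It
    satisfies each [psi w a p], as this is decided at a finite level, so it is maximal; a member of
    the cover around [e] then contradicts badness. *)
Lemma X_compact_max : X_compact Act.
Proof.
move=> I V Vo Vcov.
pose bad n (x : Dom Act) := Dmax x /\
  forall i, ~ (forall y, Dmax y -> le (dc x n) (dc y n) -> V i y).
have [N Nbad] : exists N, forall x, ~ bad N x.
  apply: contrapT => nN.
  have [||n k [x [<- [xm xP]]]|e eP] := @konig (fun n k => exists x, dc x n = k /\ bad n x).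
  - move=> n; apply: contrapT => nx; apply: nN; exists n => x bx; apply: nx.
    by exists (dc x n), x.
  - by move=> n k [x [<- _]]; apply: dgood.
  - exists x; rewrite proj_dc; split=> //; split=> // i h; apply: (xP i) => y ym xy.
    by apply: h ym _; apply: le_dc_down xy; apply: leqnSn.
  have em : Dmax e.
    apply/max_CPhi => w a p wp; have [M Mf] := sat_finitary (psi w a p).
    have [x [xe [/max_CPhi xC _]]] := eP M.
    by have [h _] := Mf x e (eq_ind_r (fun k => le k _) (le_refl _) xe); apply: h; apply: xC.
  have [i Vie] := Vcov e em; have [U [Uo VU]] := Vo i.
  have [n nU] := scott_open_level Uo (proj1 (proj1 (VU e) Vie)).
  have [x [xe [xm xP]]] := eP n; apply: (xP i) => y ym; rewrite xe => /nU Uy.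
  by apply/VU.
have [F [g gP]] := finitely_many_car N.
(* [None] is for values that no maximal element attains; [I] may be empty. *)
have pick (j : F) : exists oi : option I, forall x, Dmax x -> dc x N = g j ->
    exists2 i, oi = Some i & V i x.
  have [[x [xm xj]]|nx] := EM (exists x, Dmax x /\ dc x N = g j); last first.
    by exists None => x xm xj; case: nx; exists x.
  have [i iP] : exists i, forall y, Dmax y -> le (dc x N) (dc y N) -> V i y.
    by apply: contrapT => ni; apply: (Nbad x); split=> // i h; apply: ni; exists i.
  by exists (Some i) => y ym yj; exists i => //; apply: iP; rewrite // xj yj; apply: le_refl.
have [c cP] := choice pick.
exists (pmap c (enum F)) => x xm; have [j gj] := gP (dc x N).
have [i ci Vix] := cP j x xm (esym gj); exists i; split=> //.
elim: (enum F) (In_enum j) => [//|j' l IH] /= [->|/IH jl]; first by rewrite ci; left.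
by case: (c j') => [i'|] //; right.
Qed.

(** This makes the basic open sets clopen: their complements are given by formulas as well. *)
Lemma max_sat_em d p : Dmax d -> ~ satD true d (phi p) -> satD true d (Fneg (phi p)).
Proof.
move=> dm nd sd; apply: nd; apply: max_sat_extendable sd => //.
exact: extendable_phi.
Qed.

Lemma X_separated (x y : Dom Act) : Dmax x -> Dmax y -> ~ Dle x y ->
  exists V W, [/\ X_open V, X_open W, V x, W y & forall z, ~ (V z /\ W z)].
Proof.
move=> xm ym nxy; have [n nn] : exists n, ~ le (dc x n) (dc y n).
  by apply: contrapT => h; apply: nxy => n; apply: contrapT => hn; apply: h; exists n.
have [p [_ pP]] := phi_above (dgood x n).
exists (fun z => satD true z (phi p) /\ Dmax z), (fun z => satD true z (Fneg (phi p)) /\ Dmax z).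
split; [exact: X_open_sat | exact: X_open_sat | | | ].
- by split=> //; apply/pP; apply: le_refl.
- by split=> //; apply: max_sat_em => // /pP.
by move=> z [[zp _] [nzp _]]; apply: nzp; apply: sat_a_c.
Qed.

Lemma X_hausdorff_max : X_hausdorff Act.
Proof.
move=> x y xm ym /not_andP[nxy|nyx].
  by have [V [W [Vo Wo Vx Wy VW]]] := X_separated xm ym nxy; exists V, W.
have [V [W [Vo Wo Vy Wx VW]]] := X_separated ym xm nyx; exists W, V.
by do 4!split=> //; move=> z [Wz Vz]; apply: (VW z).
Qed.

Lemma X_zero_dim_max : X_zero_dim Act.
Proof.
move=> V x [U [Uo VU]] /VU[Ux xm]; have [n nU] := scott_open_level Uo Ux.
have [p [_ pP]] := phi_above (dgood x n).
exists (fun z => satD true z (phi p) /\ Dmax z); split; first exact: X_open_sat.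
split; last first.
  split; first by split=> //; apply/pP; apply: le_refl.
  by move=> y [/pP/nU Uy ym]; apply/VU.
have [W [Wo WP]] := X_open_sat (Fneg (phi p)); exists W; split=> // y.
split=> [[ym ny]|/WP[nyp ym]].
  by apply/WP; split=> //; apply: max_sat_em => // yp; apply: ny.
by split=> // -[yp _]; apply: nyp; apply: sat_a_c.
Qed.

(** * Image-finite labelled transition systems and density *)

Section LabelledTransitionSystem.
Variables (S : Type) (R : S -> Act -> S -> Prop).
Hypothesis Rfin : image_finite_lts R.

Definition lts_sem : S -> Dom Act := @sem S R R (fun _ _ _ h => h).

(** Image-finiteness acts as compactness: among finitely many successors, one is suitable at all
    depths. *)
Lemma lts_limit s a (P : nat -> S -> Prop) : (forall n t, P n.+1 t -> P n t) ->
  (forall n, exists t, R s a t /\ P n t) -> exists2 t, R s a t & forall n, P n t.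
Proof.
move=> PS Pex; have [l lP] := Rfin s a.
have [n t []|n|t [_ tP]] := @list_pigeonhole _ l (fun n t => R s a t /\ P n t).
- by split=> //; apply: PS.
- by have [t [st Pt]] := Pex n; exists t; split=> //; apply: lP.
by exists t => [|n]; [have [] := tP 0 | have [] := tP n].
Qed.

Lemma DRa_lts_sem s a t : R s a t -> DRa (lts_sem s) a (lts_sem t).
Proof. by move=> st n; split; [apply: dgood | exists t; split=> //; apply: le_refl]. Qed.

Lemma DRc_lts_sem s a t : R s a t -> DRc (lts_sem s) a (lts_sem t).
Proof. by move=> st n; split; [apply: dgood | exists t; split=> //; apply: le_refl]. Qed.

Lemma DRa_lts_sem_inv s a d : DRa (lts_sem s) a d ->
  exists2 t, R s a t & Dle d (lts_sem t).
Proof.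
move=> sd; apply: (@lts_limit s a (fun n t => le (dc d n) (dc (lts_sem t) n))).
  by move=> n t; apply: le_dc_down.
by move=> n; have [_] := sd n.
Qed.

Lemma DRc_lts_sem_inv s a d : DRc (lts_sem s) a d ->
  exists2 t, R s a t & Dle (lts_sem t) d.
Proof.
move=> sd; apply: (@lts_limit s a (fun n t => le (dc (lts_sem t) n) (dc d n))).
  by move=> n t; apply: le_dc_down.
by move=> n; have [_] := sd n.
Qed.

Lemma lts_sem_point s : is_lts_point (lts_sem s).
Proof.
exists S, R, s; split=> //; split.
  (* An inequality is used because a [DRc]-successor only lies above the image of some successor of
     [t]. *)
  exists (fun u v => if (u, v) is (inl t, inr d) then Dle (lts_sem t) d else False).
  split; last exact: Dle_refl.
  move=> [t|//] [//|d] /= td a; split=> [[t' tt'|//]|[//|e] de].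
    by exists (inr (lts_sem t')); split; [apply: DRa_le td _; apply: DRa_lts_sem | apply: Dle_refl].
  by have [t' tt' t'e] := DRc_lts_sem_inv (DRc_le td de); exists (inl t').
exists (fun u v => if (u, v) is (inl d, inr t) then Dle d (lts_sem t) else False).
split; last exact: Dle_refl.
move=> [d|//] [//|t] /= dt a; split=> [[e de|//]|[//|t'] tt'].
  by have [t' tt' et'] := DRa_lts_sem_inv (DRa_le dt de); exists (inr t').
by exists (inl (lts_sem t')); split; [apply: DRc_le dt _; apply: DRc_lts_sem | apply: Dle_refl].
Qed.

(** The argument is that of [CPhi_max], with the images of [R]-successors as the common generators
    of both components. *)
Lemma lts_sem_max s : Dmax (lts_sem s).
Proof.
move=> e se n; elim: n s e se => [//|n IH] s e se a; split=> x xP.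
  have [y [ey xy]] := lower_lift xP; have [z [_ ez yz]] := DRa_DRc ey.
  have [t st tz] := DRc_lts_sem_inv (DRc_le se ez).
  split; first exact: (good_lower (dgood e n.+1) xP).
  by exists t; split=> //; apply: le_trans xy (le_trans (yz n) (IH _ _ tz)).
have [gx [t [st tx]]] := xP.
have [z [_ ez tz]] := DRa_DRc (DRa_le se (DRa_lts_sem st)).
apply: (upper_closed (dgood e n.+1) gx _ (ez n)).
exact: le_trans (IH _ _ tz) tx.
Qed.

End LabelledTransitionSystem.

Lemma image_finite_level_a : image_finite_lts level_a.
Proof.
move=> [[|n] k] a; first by exists [::].
have [F [g gP]] := finitely_many_car n.
exists [seq existT (car Act) n (g i) | i <- enum F] => t [y [-> _ _]].
by have [i <-] := gP y; apply/In_map; exists i; split=> //; apply: In_enum.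
Qed.

(** Using [level_a] in both modes discards the members of U outside L, which only shrinks the upper
    component, while L cap U still generates L. *)
Lemma le_lts_sem n (k : car Act n) : good k ->
  le k (dc (lts_sem level_a (existT _ n k)) n).
Proof.
elim: n k => [//|n IH] k gk a; split=> x.
  move=> kx; split; first exact: (good_lower gk kx).
  have [y [ly [uy xy]]] := lower_upper gk kx; exists (existT _ n y).
  by split; [exists y | apply: le_trans xy (IH _ (good_lower gk ly))].
move=> [gx [t [[y [-> ly uy]] yx]]].
by apply: (upper_closed gk gx _ uy); apply: le_trans (IH _ (good_lower gk ly)) yx.
Qed.

Lemma lts_points_dense : X_dense_lts Act.
Proof.
move=> V [U [Uo VU]] [x /VU[Ux xm]]; have [n nU] := scott_open_level Uo Ux.
pose s : level_state := existT _ n (dc x n).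
exists (lts_sem level_a s); split; last exact: lts_sem_point image_finite_level_a _.
apply/VU; split; last exact: lts_sem_max image_finite_level_a _.
by apply: nU; apply: le_lts_sem; apply: dgood.
Qed.

End MixedDomain.

Theorem theorem3p20 (Act : finType) :
  (forall d : Dom Act, Dmax d <-> CPhi d) /\
  lawson_closed (@Dmax Act) /\
  X_stone Act /\
  X_dense_lts Act.
Proof.
split; first exact: max_CPhi.
split; first exact: lawson_closed_max.
split; last exact: lts_points_dense.
by split; [apply: X_compact_max | split; [apply: X_hausdorff_max | apply: X_zero_dim_max]].
Qed.
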